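(* Let $F$ be a probability distribution supported on $[0,1]^d$ with a density $f$ that is positive a.e. on $[0,1]^d$, and let $v_F$ be an $F$-Brownian bridge. Let $A\subset[0,1]^d$ be a fixed measurable set and let $\eta_A\ge 0$ be such that $\eta_A^2$ is a probability density on $A$, i.e. $\eta_A(x)=0$ for $x\notin A$ and $\int_A\eta_A^2(x)\,\mathrm{d}x=1$; assume $\eta_A\neq\sqrt f$ (as elements of $L_2([0,1]^d)$). Then the process $b$ with differential $$b(\mathrm{d}x)=\frac{v_F(\mathrm{d}x)}{\sqrt{f(x)}}-\int_{y\in A}\eta_A(y)\,\frac{v_F(\mathrm{d}y)}{\sqrt{f(y)}}\;\frac{1}{1-\int_{y\in A}\eta_A(y)\sqrt{f(y)}\,\mathrm{d}y}\,\bigl(\eta_A(x)-\sqrt{f(x)}\bigr)\,\mathrm{d}x$$ is a standard Brownian motion on $[0,1]^d\setminus A$, while $$\int_{y\in A}\eta_A(y)\,b(\mathrm{d}y)=0 .$$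
   Context: For a probability distribution $F$ on $\mathbb{R}^d$, write $\langle\phi,\tilde\phi\rangle_F=\int\phi\tilde\phi\,\mathrm{d}F$ and let $q_0$ be the function identically equal to $1$. An $F$-Brownian motion $w_F$ is a family of centered jointly Gaussian random variables $w_F(\phi)$, $\phi\in L_2(F)$, (a.s.) linear in $\phi$, with $E\,w_F(\phi)w_F(\tilde\phi)=\langle\phi,\tilde\phi\rangle_F$. An $F$-Brownian bridge is a family distributed as $v_F(\phi)=w_F(\phi)-\langle\phi,q_0\rangle_F w_F(q_0)$, $\phi\in L_2(F)$. One writes $\int\phi(y)\,v_F(\mathrm{d}y)=v_F(\phi)$. The differential formula for $b$ is understood in function-parametric form: for $\phi\in L_2([0,1]^d)$ (Lebesgue measure), $$b(\phi)=\int\phi(x)\,b(\mathrm{d}x)=v_F\bigl(\phi/\sqrt f\bigr)-v_F\bigl(\eta_A/\sqrt f\bigr)\frac{1}{1-\int_A\eta_A\sqrt f\,\mathrm{d}y}\int_{[0,1]^d}\phi(x)\bigl(\eta_A(x)-\sqrt{f(x)}\bigr)\,\mathrm{d}x .$$ ''Standard Brownian motion on $[0,1]^d\setminus A$'' means that the restriction of $b$ to functions $\phi\in L_2([0,1]^d)$ vanishing on $A$ is a linear family of centered jointly Gaussian variables with covariance $E\,b(\phi)b(\tilde\phi)=\int\phi\tilde\phi\,\mathrm{d}x$. *)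

(* Defs.v *)
From HB Require Import structures.
From mathcomp Require Import all_boot all_order all_algebra.
From mathcomp Require Import all_classical all_reals all_analysis.

Set Implicit Arguments.
Unset Strict Implicit.
Unset Printing Implicit Defensive.

Import Order.TTheory GRing.Theory Num.Theory.
Import numFieldNormedType.Exports.

Local Open Scope classical_set_scope.
Local Open Scope ring_scope.

(* The library has no d-fold product of a measure: it is built here by
   iterating the binary product, on d.-tuple T with its product sigma-algebra. *)
Section power_measure.
Context {disp : measure_display} {T : measurableType disp} {R : realType}.
Variable mu : {sigma_finite_measure set T -> \bar R}.

Definition tcons (d : nat) (p : T * d.-tuple T) : d.+1.-tuple T :=
  [tuple of p.1 :: p.2].

Lemma measurable_tcons d : measurable_fun [set: T * d.-tuple T] (@tcons d).
Proof. exact: measurable_cons. Qed.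

Section power_measure_step.
Variables (d : nat) (m : {sigma_finite_measure set (d.-tuple T) -> \bar R}).

Definition power_measure_step : set (d.+1.-tuple T) -> \bar R :=
  pushforward (mu \x m)%E (@tcons d).

Let step0 : power_measure_step set0 = 0%E.
Proof. by rewrite /power_measure_step /pushforward preimage_set0 measure0. Qed.

Let step_ge0 A : (0 <= power_measure_step A)%E.
Proof. exact: (measure_ge0 (mu \x m)%E). Qed.

Let step_sigma_additive : semi_sigma_additive power_measure_step.
Proof.
move=> F mF tF mUF; rewrite /power_measure_step /pushforward preimage_bigcup.
apply: measure_semi_sigma_additive => [n||].
- by rewrite -[X in measurable X]setTI; exact: measurable_tcons.
- apply/trivIsetP => i j _ _ ij; rewrite -preimage_setI.
  by move/trivIsetP : tF => ->//; rewrite preimage_set0.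
- rewrite -preimage_bigcup -[X in measurable X]setTI.
  exact: measurable_tcons.
Qed.

HB.instance Definition _ := isMeasure.Build _ _ _ power_measure_step
  step0 step_ge0 step_sigma_additive.

Let step_sigma_finite : sigma_finite setT power_measure_step.
Proof.
have [F FT Foo] : sigma_finite setT (mu \x m)%E.
  have /sigma_finiteP[F [TF ndF Foo]] := sigma_finiteT mu.
  have /sigma_finiteP[G [TG ndG Goo]] := sigma_finiteT m.
  exists (fun n => F n `*` G n).
    rewrite -setXTT TF TG predeqE => -[x y]; split.
      move=> [/= [n _ Fnx] [k _ Gky]]; exists (maxn n k) => //; split.
      - by move: x Fnx; exact/subsetPset/ndF/leq_maxl.
      - by move: y Gky; exact/subsetPset/ndG/leq_maxr.
    by move=> [n _ []/= ? ?]; split; exists n.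
  move=> k; have [? ?] := Foo k; have [? ?] := Goo k.
  split; first exact: measurableX.
  by rewrite product_measure1E// lte_mul_pinfty// ge0_fin_numE.
pose tuncons (t : d.+1.-tuple T) : T * d.-tuple T :=
  (thead t, [tuple of behead t]).
have mtuncons : measurable_fun setT tuncons.
  apply: measurable_fun_pair; last exact: measurable_behead.
  exact: measurable_tnth.
have tconsK : cancel (@tcons d) tuncons.
  by move=> [x t]; congr pair; apply/val_inj.
exists (fun n => tuncons @^-1` F n).
  by rewrite -preimage_bigcup -FT preimage_setT.
move=> n; have [mF Fnoo] := Foo n; split.
  by rewrite -[X in measurable X]setTI; exact: mtuncons.
rewrite /power_measure_step /pushforward -comp_preimage.
by rewrite (_ : tuncons \o @tcons d = id) //; exact/funext.
Qed.

HB.instance Definition _ := Measure_isSigmaFinite.Build _ _ _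
  power_measure_step step_sigma_finite.

End power_measure_step.

Fixpoint power_measure (d : nat) :
    {sigma_finite_measure set (d.-tuple T) -> \bar R} :=
  if d is d'.+1 then power_measure_step (power_measure d')
  else \d_([tuple] : 0.-tuple T).

Lemma power_measure_box (d : nat) (B : 'I_d -> set T) :
  (forall i, measurable (B i)) ->
  power_measure d [set t | forall i, B i (tnth t i)] =
  (\prod_(i < d) mu (B i))%E.
Proof.
elim: d B => [|d IH] B mB.
  rewrite big_ord0 /= diracE mem_set//=.
  by case.
rewrite big_ord_recl -IH//= /power_measure_step /pushforward.
rewrite -product_measure1E//; last first.
  have -> : [set t : d.-tuple T | forall i, B (lift ord0 i) (tnth t i)] =
    \bigcap_(i in [set: 'I_d]) ((fun t => tnth t i) @^-1` B (lift ord0 i)).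
    by apply/seteqP; split=> t /= H i; [move=> _; exact: H | exact: (H i I)].
  apply: fin_bigcap_measurable => // i _.
  by rewrite -[X in measurable X]setTI; exact: measurable_tnth.
congr product_measure1; apply/seteqP; split => -[x t] /=.
  move=> H; split=> [|i]; first exact: (H ord0).
  have := H (lift ord0 i); rewrite /tcons tnthS.
  by congr (B _ (tnth _ _)); apply/val_inj.
move=> [Bx Bt] i; case: (unliftP ord0 i) => [j ->|->//].
have := Bt j; rewrite /tcons tnthS.
by congr (B _ (tnth _ _)); apply/val_inj.
Qed.

End power_measure.

(* R^d, with its Borel sigma-algebra. *)
Notation Rd R d := (d.-tuple (measurableTypeR R)).

Definition lebesgue_Rd (R : realType) (d : nat) :
    {sigma_finite_measure set (Rd R d) -> \bar R} :=
  power_measure (@lebesgue_measure R) d.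

Definition cube (R : realType) (d : nat) : set (Rd R d) :=
  [set t | forall i : 'I_d, 0 <= (tnth t i : R) <= 1].
Arguments cube : clear implicits.

Lemma measurable_cube (R : realType) (d : nat) : measurable (cube R d).
Proof.
have -> : cube R d = \bigcap_(i in [set: 'I_d])
    ((fun t : Rd R d => tnth t i) @^-1` (`[0, 1]%classic : set R)).
  apply/seteqP; split=> t /= H i; first by move=> _; rewrite /= in_itv; exact: H.
  by have := H i I; rewrite /= in_itv.
apply: fin_bigcap_measurable => // i _.
rewrite -[X in measurable X]setTI; exact: measurable_tnth.
Qed.

Definition lebesgue_cube (R : realType) (d : nat) :
    {measure set (Rd R d) -> \bar R} :=
  mrestr (lebesgue_Rd R d) (@measurable_cube R d).

(* The elements of L_2(mu) are represented by functions, not by classes. *)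
Definition L2 {disp : measure_display} {T : measurableType disp}
    {R : realType} (mu : {measure set T -> \bar R}) : set (T -> R) :=
  [set phi | phi \in Lfun mu 2%:E].

Definition inner {disp : measure_display} {T : measurableType disp}
    {R : realType} (mu : {measure set T -> \bar R}) (phi psi : T -> R) : R :=
  \int[mu]_x (phi x * psi x).

(* Degenerate laws are Gaussian; they are singled out because normal_prob m 0
   is not the Dirac mass at m. *)
Definition gaussian {disp : measure_display} {O : measurableType disp}
    {R : realType} (P : probability O R) (X : O -> R) : Prop :=
  exists m s : R, forall B : set R, measurable B ->
    P (X @^-1` B) = if s == 0 then \d_m B else normal_prob m s B.

Definition jointly_gaussian {disp : measure_display} {O : measurableType disp}
    {R : realType} (P : probability O R) {I : Type} (D : set I)
    (X : I -> O -> R) : Prop :=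
  forall (n : nat) (i : 'I_n -> I) (c : 'I_n -> R), (forall k, D (i k)) ->
    gaussian P (fun o => \sum_(k < n) c k * X (i k) o).

(* X, indexed by the functions in D, is an (a.s.) linear family of centered
   jointly Gaussian variables whose covariance is the inner product of
   L_2(mu).  The values of X outside of D are irrelevant. *)
Record brownian_on {d1 d2 : measure_display} {T : measurableType d1}
    {O : measurableType d2} {R : realType} (mu : {measure set T -> \bar R})
    (D : set (T -> R)) (P : probability O R) (X : (T -> R) -> O -> R) : Prop :=
  BrownianOn {
    brownian_rv : forall phi, D phi -> measurable_fun [set: O] (X phi);
    brownian_linear : forall (a b : R) phi psi, D phi -> D psi ->
      {ae P, forall o, X (fun x => a * phi x + b * psi x) o =
                       a * X phi o + b * X psi o};
    brownian_gaussian : jointly_gaussian P D X;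
    brownian_centered : forall phi, D phi -> ('E_P[X phi] = 0)%E;
    brownian_cov : forall phi psi, D phi -> D psi ->
      ('E_P[fun o => (X phi o * X psi o)%R] = (inner mu phi psi)%:E)%E }.

Definition brownian_motion {d1 d2 : measure_display} {T : measurableType d1}
    {O : measurableType d2} {R : realType} (F : probability T R)
    (P : probability O R) (w : (T -> R) -> O -> R) : Prop :=
  brownian_on F (L2 F) P w.

(* Equality of all finite-dimensional distributions. *)
Definition same_law {d1 d2 : measure_display} {O1 : measurableType d1}
    {O2 : measurableType d2} {R : realType} (P1 : probability O1 R)
    (P2 : probability O2 R) {I : Type} (D : set I)
    (X1 : I -> O1 -> R) (X2 : I -> O2 -> R) : Prop :=
  forall (n : nat) (i : 'I_n -> I), (forall k, D (i k)) ->
    forall B : set (n.-tuple R), measurable B ->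
      P1 [set o | B [tuple X1 (i k) o | k < n]] =
      P2 [set o | B [tuple X2 (i k) o | k < n]].

(* The F-Brownian motion may live on another probability space. *)
Definition brownian_bridge {d1 d2 : measure_display} {T : measurableType d1}
    {O : measurableType d2} {R : realType} (F : probability T R)
    (P : probability O R) (v : (T -> R) -> O -> R) : Prop :=
  (forall phi, L2 F phi -> measurable_fun [set: O] (v phi)) /\
  exists (d' : measure_display) (O' : measurableType d')
      (P' : probability O' R) (w : (T -> R) -> O' -> R),
    brownian_motion F P' w /\
    same_law P P' (L2 F) v
      (fun phi o => w phi o - inner F phi (cst 1) * w (cst 1) o).

(* The process b, in function-parametric form: b(phi) = int phi(x) b(dx). *)
Definition transformed {disp : measure_display} {O : measurableType disp}
    {R : realType} {d : nat} (v : (Rd R d -> R) -> O -> R)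
    (f : Rd R d -> R) (A : set (Rd R d)) (eta : Rd R d -> R)
    (phi : Rd R d -> R) : O -> R :=
  fun o =>
    v (fun x => phi x / Num.sqrt (f x)) o -
    v (fun x => eta x / Num.sqrt (f x)) o *
    (1 / (1 - \int[lebesgue_Rd R d]_(y in A) (eta y * Num.sqrt (f y)))) *
    \int[lebesgue_Rd R d]_(x in cube R d) (phi x * (eta x - Num.sqrt (f x))).

(* Main.v *)
Require Import Defs.
From mathcomp Require Import all_boot all_order all_algebra.
From mathcomp Require Import all_classical all_reals all_analysis.
From mathcomp Require Import measurable_realfun ring.

Set Implicit Arguments.
Unset Strict Implicit.
Unset Printing Implicit Defensive.

Import Order.TTheory GRing.Theory Num.Theory.
Import numFieldNormedType.Exports.

Local Open Scope classical_set_scope.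
Local Open Scope ring_scope.

(** Write [s] for [sqrt f] and [e] for [eta].  Both are unit vectors of the
    [L_2] space of the cube, and [|e - s|^2 = 2 (1 - <e, s>)], which is nonzero
    because they differ.  The reflection that exchanges them is therefore
      [U phi = phi - <phi, e - s> (e - s) / (1 - <e, s>)].
    A bridge vanishes almost surely on constants, hence on [s / s], so adding a
    multiple of [s] to the argument of [phi |-> v (phi / s)] changes nothing;
    together with the almost sure linearity of [v] this turns the differential
    formula into [b phi = v (U phi / s)] almost surely.

    Division by [s] carries the [L_2] space of the cube isometrically into
    [L_2 F], since [s^2 = f] is positive almost everywhere and is the density of
    [F] ([inner_div]), and it sends [s] to the constant [1].  On the other hand
    the bridge is a Brownian motion evaluated at [center F phi], the component
    of [phi] orthogonal to [1] ([bridge_field]).  If [phi] is orthogonal to [e],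
    in particular if it vanishes on [A], then [U phi] is orthogonal to
    [U e = s], centering leaves [U phi / s] unchanged, and
      [E (b phi) (b psi) = <U phi, U psi> = <phi, psi>].
    At [phi = e] one gets [U e = s], where the bridge is zero.

    The remaining work is to transport everything else that makes up a Brownian
    motion (measurability, almost sure linearity, joint Gaussianity, centering)
    from the Brownian motion behind the bridge to [b].  This takes three steps:
    reindexing by a linear map ([gaussian_field_comp]), almost sure modification
    ([gaussian_field_ae]) and equality of finite-dimensional distributions
    ([gaussian_field_same_law]).  The argument is carried out for a probability
    with an almost everywhere positive density with respect to an arbitrary
    measure ([bridge_transform_motion]); the cube enters only at the end,
    through the restriction of Lebesgue measure to it. *)

(** * The inner product of L_2 *)

Section inner_product.
Context {disp : measure_display} {T : measurableType disp} {R : realType}.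
Implicit Types (mu : {measure set T -> \bar R}) (phi psi chi : T -> R).

Lemma L2_measurable mu phi : L2 mu phi -> measurable_fun setT phi.
Proof. by rewrite /L2/= inE => /andP[]; rewrite inE. Qed.

Lemma L2P mu phi : L2 mu phi <-> measurable_fun setT phi /\
  (\int[mu]_x (phi x ^+ 2)%:E < +oo)%E.
Proof.
split=> [phi2|[mphi phi2]].
  have mphi := L2_measurable phi2; split=> //.
  have /integrableP[_] := Lfun2_integrable_sqr phi2.
  apply: le_lt_trans; apply: ge0_le_integral => //.
  - by move=> x _; rewrite lee_fin sqr_ge0.
  - by apply/measurable_EFinP; exact: measurable_funX.
  - by apply: measurableT_comp => //; apply/measurable_EFinP;
      exact: measurable_funX.
  - by move=> x _; rewrite lee_abs.
rewrite /L2/= inE; apply/andP; split; rewrite inE//= /finite_norm unlock.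
rewrite poweR_lty//; apply: le_lt_trans phi2.
rewrite le_eqVlt; apply/orP; left; apply/eqP; apply: eq_integral => x _ /=.
by rewrite powR_mulrn// real_normK ?num_real.
Qed.

Lemma L2_lin mu (a b : R) phi psi : L2 mu phi -> L2 mu psi ->
  L2 mu (fun x => a * phi x + b * psi x).
Proof.
have two : (1 <= 2%:E :> \bar R)%E by rewrite lee_fin ler1n.
move=> Hphi Hpsi; have [L20 L2Z] := Lfun_submod_closed mu two.
have := L2Z a phi _ Hphi (L2Z b psi 0 Hpsi L20).
by rewrite addr0.
Qed.

Lemma L2_mul_integrable mu phi psi : L2 mu phi -> L2 mu psi ->
  mu.-integrable setT (EFin \o (fun x => phi x * psi x)).
Proof. by move=> Hphi Hpsi; exact/Lfun1_integrable/Lfun2_mul_Lfun1. Qed.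

Lemma inner_sym mu phi psi : inner mu phi psi = inner mu psi phi.
Proof. by apply: eq_Rintegral => x _; rewrite mulrC. Qed.

Lemma inner_lin mu (a b : R) phi psi chi :
  L2 mu phi -> L2 mu psi -> L2 mu chi ->
  inner mu (fun x => a * phi x + b * psi x) chi =
  a * inner mu phi chi + b * inner mu psi chi.
Proof.
move=> Hphi Hpsi Hchi.
have IZ c g : L2 mu g ->
    mu.-integrable setT (EFin \o (fun x => c * (g x * chi x))).
  by move=> Hg; exact: (integrableZl measurableT c (L2_mul_integrable Hg Hchi)).
rewrite /inner -!RintegralZl//; try exact: L2_mul_integrable.
rewrite -RintegralD//; try exact: IZ.
by apply: eq_Rintegral => x _; rewrite mulrDl !mulrA.
Qed.

Lemma inner_linr mu (a b : R) phi psi chi :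
  L2 mu phi -> L2 mu psi -> L2 mu chi ->
  inner mu chi (fun x => a * phi x + b * psi x) =
  a * inner mu chi phi + b * inner mu chi psi.
Proof. by move=> *; rewrite inner_sym inner_lin// !(inner_sym _ chi). Qed.

Lemma ae_eq_inner mu phi psi phi' psi' :
  measurable_fun setT (fun x => phi x * psi x) ->
  measurable_fun setT (fun x => phi' x * psi' x) ->
  {ae mu, forall x, phi x * psi x = phi' x * psi' x} ->
  inner mu phi psi = inner mu phi' psi'.
Proof.
move=> m1 m2 e; rewrite /inner /Rintegral; congr fine.
apply: ae_eq_integral => //; try exact/measurable_EFinP.
by apply: filterS e => x /= + _ => ->.
Qed.

Lemma inner_self mu phi : L2 mu phi ->
  (inner mu phi phi)%:E = (\int[mu]_x (phi x ^+ 2)%:E)%E.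
Proof.
move=> Hphi; rewrite /inner /Rintegral fineK.
  by apply: eq_integral => x _; rewrite expr2.
exact: integrable_fin_num (L2_mul_integrable Hphi Hphi).
Qed.

Lemma inner_self_eq0 mu phi : L2 mu phi -> inner mu phi phi = 0 ->
  {ae mu, forall x, phi x = 0}.
Proof.
move=> Hphi phi0; have := inner_self Hphi; rewrite {}phi0 => phi0.
have mphi := L2_measurable Hphi.
have : (\int[mu]_x `|(phi x ^+ 2)%:E| = 0)%E.
  rewrite [RHS]phi0; apply: eq_integral => x _.
  by rewrite gee0_abs// lee_fin sqr_ge0.
have mphi2 : measurable_fun setT (fun x => (phi x ^+ 2)%:E).
  by apply/measurable_EFinP; exact: measurable_funX.
have aeP := ae_eq_integral_abs mu measurableT mphi2.
case: aeP => + _ => /[apply] {}phi0.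
by apply: filterS phi0 => x /= /(_ I)[] /eqP; rewrite sqrf_eq0 => /eqP.
Qed.

End inner_product.

(** * Expectations and laws *)

Section law.
Context {R : realType}.

(** Transporting the positive and the negative part separately gives the identity
    for integrable and non-integrable [g] alike. *)
Lemma expectation_pushforward {d1 d2 : measure_display} {O : measurableType d1}
    {Y : measurableType d2} (P : probability O R) (h : O -> Y) (g : Y -> R) :
  measurable_fun setT h -> measurable_fun setT g ->
  ('E_P[g \o h] = \int[pushforward P h]_y (g y)%:E)%E.
Proof.
move=> mh mg; rewrite unlock integralE [RHS]integralE.
have mG : measurable_fun setT (fun y => (g y)%:E) by exact/measurable_EFinP.
rewrite !ge0_integral_pushforward//; last 2 first.
  exact: measurable_funeneg.
  exact: measurable_funepos.
by rewrite -funepos_comp -funeneg_comp.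
Qed.

Lemma ae_eq_expectation {d : measure_display} {O : measurableType d}
    (P : probability O R) (X Y : O -> R) :
  measurable_fun setT X -> measurable_fun setT Y ->
  {ae P, forall o, X o = Y o} -> ('E_P[X] = 'E_P[Y])%E.
Proof.
move=> mX mY XY; rewrite unlock.
apply: ae_eq_integral => //; try exact/measurable_EFinP.
by apply: filterS XY => o /= -> _.
Qed.

Lemma ae_eq_probability {d : measure_display} {O : measurableType d}
    (P : probability O R) (X Y : O -> R) (B : set R) :
  measurable_fun setT X -> measurable_fun setT Y -> measurable B ->
  {ae P, forall o, X o = Y o} -> P (X @^-1` B) = P (Y @^-1` B).
Proof.
move=> mX mY mB XY.
have mp (Z : O -> R) : measurable_fun setT Z -> measurable (Z @^-1` B).
  by move=> mZ; rewrite -[Z in measurable Z]setTI; exact: mZ.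
rewrite -!expectation_indic; try exact: mp.
apply: ae_eq_expectation; try by apply: measurable_indic; exact: mp.
apply: filterS XY => o /= XYo; rewrite !indicE.
suff -> : (o \in X @^-1` B) = (o \in Y @^-1` B) by [].
by apply/idP/idP; rewrite !inE /preimage/= XYo.
Qed.

Lemma same_law_expectation {d1 d2 : measure_display} {O1 : measurableType d1}
    {O2 : measurableType d2} (P1 : probability O1 R) (P2 : probability O2 R)
    {I : Type} (D : set I) (X1 : I -> O1 -> R) (X2 : I -> O2 -> R) :
  (forall i, D i -> measurable_fun setT (X1 i)) ->
  (forall i, D i -> measurable_fun setT (X2 i)) ->
  same_law P1 P2 D X1 X2 ->
  forall (n : nat) (i : 'I_n -> I) (g : n.-tuple R -> R),
    (forall k, D (i k)) -> measurable_fun setT g ->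
    ('E_P1[fun o => g [tuple X1 (i k) o | k < n]] =
     'E_P2[fun o => g [tuple X2 (i k) o | k < n]])%E.
Proof.
move=> mX1 mX2 law n i g Di mg.
have mtuple d (O : measurableType d) (X : I -> O -> R) :
    (forall i, D i -> measurable_fun setT (X i)) ->
    measurable_fun setT (fun o => [tuple X (i k) o | k < n] : n.-tuple R).
  move=> mX; apply/measurable_fun_tnthP => k.
  rewrite (_ : _ \o _ = X (i k)); first exact: mX.
  by apply/funext => o /=; rewrite tnth_mktuple.
pose h1 o : n.-tuple R := [tuple X1 (i k) o | k < n].
pose h2 o : n.-tuple R := [tuple X2 (i k) o | k < n].
rewrite -[X in ('E_P1[X])%E]/(g \o h1) -[X in ('E_P2[X])%E]/(g \o h2).
have mh1 : measurable_fun setT h1 by exact: mtuple.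
have mh2 : measurable_fun setT h2 by exact: mtuple.
rewrite !expectation_pushforward//.
apply: (eq_measure_integral (pushforward P2 h2)).
by move=> B mB _; exact: law.
Qed.

End law.

(** * Linear Gaussian families *)

Section gaussian_field.
Context {d1 : measure_display} {T : measurableType d1} {R : realType}.

(** The covariance [K] is kept arbitrary because that of a bridge is not the
    inner product; [brownian_on mu] is the case [K = inner mu]. *)
Record gaussian_field {d2 : measure_display} {O : measurableType d2}
    (K : (T -> R) -> (T -> R) -> R) (D : set (T -> R)) (P : probability O R)
    (X : (T -> R) -> O -> R) : Prop := GaussianField {
  field_measurable : forall phi, D phi -> measurable_fun [set: O] (X phi);
  field_linear : forall (a b : R) phi psi, D phi -> D psi ->
    {ae P, forall o, X (fun x => a * phi x + b * psi x) o =
                     a * X phi o + b * X psi o};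
  field_gaussian : jointly_gaussian P D X;
  field_centered : forall phi, D phi -> ('E_P[X phi] = 0)%E;
  field_cov : forall phi psi, D phi -> D psi ->
    ('E_P[fun o => (X phi o * X psi o)%R] = (K phi psi)%:E)%E }.

Definition lin_closed (D : set (T -> R)) := forall (a b : R) phi psi,
  D phi -> D psi -> D (fun x => a * phi x + b * psi x).

Lemma gaussian_field_comp {d2 : measure_display} {O : measurableType d2}
    (P : probability O R) K (D D' : set (T -> R)) (X : (T -> R) -> O -> R)
    (S : (T -> R) -> T -> R) :
  gaussian_field K D P X -> (forall phi, D' phi -> D (S phi)) ->
  (forall (a b : R) phi psi, D' phi -> D' psi ->
     S (fun x => a * phi x + b * psi x) =
     (fun x => a * S phi x + b * S psi x)) ->
  gaussian_field (fun phi psi => K (S phi) (S psi)) D' P (X \o S).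
Proof.
move=> [mX linX gX cX covX] DS linS; split=> /=.
- by move=> phi /DS /mX.
- by move=> a b phi psi D1 D2; rewrite linS//; apply: linX; exact: DS.
- by move=> n i c Di; apply: (gX n (S \o i) c) => k; exact: DS.
- by move=> phi /DS /cX.
- by move=> phi psi /DS D1 /DS D2; exact: covX.
Qed.

Lemma gaussian_field_ae {d2 : measure_display} {O : measurableType d2}
    (P : probability O R) K (D : set (T -> R)) (X Y : (T -> R) -> O -> R) :
  lin_closed D -> gaussian_field K D P X ->
  (forall phi, D phi -> measurable_fun setT (Y phi)) ->
  (forall phi, D phi -> {ae P, forall o, X phi o = Y phi o}) ->
  gaussian_field K D P Y.
Proof.
move=> Dlin [mX linX gX cX covX] mY XY; split=> //.
- move=> a b phi psi D1 D2.
  apply: filterS3 (linX a b _ _ D1 D2) (XY _ D1) _; last first.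
    exact: filterI (XY _ D2) (XY _ (Dlin a b _ _ D1 D2)).
  by move=> o /= + e1 [e2 e3]; rewrite e1 e2 e3.
- move=> n i c Di; have [m [s ms]] := gX n i c Di; exists m, s => B mB.
  rewrite -ms//; apply: ae_eq_probability => //.
  + by apply: measurable_sum => k; apply: measurable_funM => //; exact: mY.
  + by apply: measurable_sum => k; apply: measurable_funM => //; exact: mX.
  + have : {ae P, forall o, forall k : 'I_n, X (i k) o = Y (i k) o}.
      by apply: filter_forall => k; exact: XY.
    by apply: filterS => o /= XYo; apply: eq_bigr => k _; rewrite XYo.
- move=> phi D1; rewrite -(cX phi D1); apply: ae_eq_expectation => //.
  + exact: mY.
  + exact: mX.
  + by apply: filterS (XY _ D1) => o ->.
- move=> phi psi D1 D2; rewrite -covX//; apply: ae_eq_expectation => //.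
  + by apply: measurable_funM; exact: mY.
  + by apply: measurable_funM; exact: mX.
  + by apply: filterS2 (XY _ D1) (XY _ D2) => o -> ->.
Qed.

(** Each clause concerns finitely many values of the family: Gaussianity and the
    two moments directly, and linearity because it says that the expectation
    of the absolute value of the defect is zero. *)
Lemma gaussian_field_same_law {d2 d3 : measure_display}
    {O1 : measurableType d2} {O2 : measurableType d3}
    (P1 : probability O1 R) (P2 : probability O2 R) K (D : set (T -> R))
    (X1 : (T -> R) -> O1 -> R) (X2 : (T -> R) -> O2 -> R) :
  lin_closed D -> (forall phi, D phi -> measurable_fun setT (X1 phi)) ->
  same_law P1 P2 D X1 X2 -> gaussian_field K D P2 X2 ->
  gaussian_field K D P1 X1.
Proof.
move=> Dlin mX1 law [mX2 linX gX cX covX].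
have Elaw := same_law_expectation mX1 mX2 law.
have mt n (k : 'I_n) : measurable_fun setT (fun t : n.-tuple R => tnth t k : R).
  exact: measurable_tnth.
split=> //.
- move=> a b phi psi D1 D2.
  pose i (k : 'I_3) :=
    if k == ord0 then phi else if k == ord_max then psi else
    (fun x => a * phi x + b * psi x).
  have Di k : D (i k).
    by rewrite /i; case: ifP => // _; case: ifP => // _; exact: Dlin.
  pose k1 : 'I_3 := Ordinal (isT : (1 < 3)%N).
  pose g (t : 3.-tuple R) :=
    `|tnth t k1 - (a * tnth t ord0 + b * tnth t ord_max)|.
  have mg : measurable_fun setT g.
    apply: measurableT_comp => //; apply: measurable_funB; first exact: mt.
    by apply: measurable_funD; apply: measurable_funM => //; exact: mt.
  have defect d (O : measurableType d) (P : probability O R) X :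
      (forall phi, D phi -> measurable_fun setT (X phi)) ->
      ('E_P[fun o => g [tuple X (i k) o | k < 3]] = 0)%E <->
      {ae P, forall o, X (fun x => a * phi x + b * psi x) o =
                       a * X phi o + b * X psi o}.
    move=> mX.
    have -> : (fun o => g [tuple X (i k) o | k < 3]) =
        (fun o => `|X (fun x => a * phi x + b * psi x) o -
                    (a * X phi o + b * X psi o)|).
      by apply/funext => o; rewrite /g !tnth_mktuple.
    have mdef : measurable_fun setT (fun o =>
        (X (fun x => a * phi x + b * psi x) o -
         (a * X phi o + b * X psi o))%:E).
      apply/measurable_EFinP; apply: measurable_funB.
        by apply: mX; exact: Dlin.
      by apply: measurable_funD; apply: measurable_funM => //; exact: mX.
    rewrite unlock; split=> [|XE].
      move/(ae_eq_integral_abs P measurableT mdef); apply: filterS => o /=.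
      by move=> /(_ I)[] /eqP; rewrite subr_eq0 => /eqP.
    apply/(ae_eq_integral_abs P measurableT mdef); apply: filterS XE => o /=.
    by move=> -> _; rewrite subrr.
  apply/(defect _ _ P1 X1 mX1); rewrite Elaw//.
  by apply/defect => //; exact: linX.
- move=> n i c Di; have [m [s ms]] := gX n i c Di; exists m, s => B mB.
  rewrite -ms//.
  have mB' : measurable [set t : n.-tuple R | B (\sum_(k < n) c k * tnth t k)].
    rewrite -[X in measurable X]setTI.
    apply: (_ : measurable_fun setT (fun t : n.-tuple R =>
      \sum_(k < n) c k * tnth t k)) => //.
    apply: measurable_sum => k; apply: measurable_funM => //; exact: mt.
  have sumE O (X : (T -> R) -> O -> R) :
      [set o | B (\sum_(k < n) c k * tnth [tuple X (i k) o | k < n] k)] =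
      [set o | B (\sum_(k < n) c k * X (i k) o)].
    apply/seteqP; split=> o /=; congr B; apply: eq_bigr => k _;
    by rewrite tnth_mktuple.
  by have := law n i Di _ mB'; rewrite /= !sumE.
- move=> phi D1; rewrite -(cX phi D1).
  have tE O (X : (T -> R) -> O -> R) :
      X phi = (fun o => tnth [tuple X phi o | k < 1] ord0).
    by apply/funext => o; rewrite tnth_mktuple.
  by rewrite (tE O1) (tE O2) (Elaw 1 (fun=> phi) (fun t => tnth t ord0)).
- move=> phi psi D1 D2; rewrite -covX//.
  pose i (k : 'I_2) := if k == ord0 then phi else psi.
  have Di k : D (i k) by rewrite /i; case: ifP.
  have tE O (X : (T -> R) -> O -> R) : (fun o => X phi o * X psi o) =
      (fun o => tnth [tuple X (i k) o | k < 2] ord0 *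
                tnth [tuple X (i k) o | k < 2] ord_max).
    by apply/funext => o; rewrite !tnth_mktuple.
  rewrite (tE O1) (tE O2) (Elaw 2 i (fun t => tnth t ord0 * tnth t ord_max))//.
  by apply: measurable_funM; exact: mt.
Qed.

End gaussian_field.

(** * The bridge as a centered Brownian motion *)

Lemma L2_cst {disp : measure_display} {T : measurableType disp}
    {R : realType} (F : probability T R) (c : R) : L2 F (cst c).
Proof. exact: Lfun_cst. Qed.

Section bridge.
Context {d1 : measure_display} {T : measurableType d1} {R : realType}.
Variable F : probability T R.

(** The orthogonal projection of [L_2 F] along the constants. *)
Definition center (phi : T -> R) : T -> R :=
  fun x => phi x - inner F phi (cst 1).

Let centerE phi : center phi =
  (fun x => 1 * phi x + (- inner F phi (cst 1)) * cst 1 x).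
Proof. by apply/funext => x; rewrite mul1r mulr1. Qed.

Lemma L2_center phi : L2 F phi -> L2 F (center phi).
Proof. by move=> Hphi; rewrite centerE; apply: L2_lin => //; exact: L2_cst. Qed.

Lemma center_lin (a b : R) phi psi : L2 F phi -> L2 F psi ->
  center (fun x => a * phi x + b * psi x) =
  (fun x => a * center phi x + b * center psi x).
Proof.
move=> H1 H2; apply/funext => x.
by rewrite /center inner_lin//; [ring|exact: L2_cst].
Qed.

Lemma inner_center phi psi : L2 F phi -> L2 F psi ->
  inner F (center phi) (center psi) =
  inner F phi psi - inner F phi (cst 1) * inner F psi (cst 1).
Proof.
move=> H1 H2; have H0 := L2_cst F 1.
have one : inner F (cst 1) (cst 1) = 1.
  apply: EFin_inj; rewrite inner_self//.
  under eq_integral do rewrite expr1n.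
  by rewrite integral_cst// mul1e; exact: probability_setT.
rewrite !centerE inner_lin//; last by rewrite -centerE; exact: L2_center.
by rewrite !inner_linr// one (inner_sym F (cst 1) psi); ring.
Qed.

(** The defining combination [w phi - <phi, 1> w 1] equals [w (center phi)]
    almost surely, by linearity of [w]. *)
Lemma bridge_field {d2 : measure_display} {O : measurableType d2}
    (P : probability O R) (v : (T -> R) -> O -> R) :
  brownian_bridge F P v ->
  gaussian_field (fun phi psi => inner F (center phi) (center psi)) (L2 F) P v.
Proof.
case=> mv [d2' [U [P2 [w [[mw linw gw cw covw] law]]]]].
have L2lin : lin_closed (L2 F) by move=> *; exact: L2_lin.
apply: (gaussian_field_same_law L2lin mv law).
have fw : gaussian_field (inner F) (L2 F) P2 w by split.
have := gaussian_field_comp fw L2_center center_lin.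
move/(gaussian_field_ae L2lin); apply.
- move=> phi Hphi; apply: measurable_funB; first exact: mw.
  by apply: measurable_funM => //; apply: mw; exact: L2_cst.
- move=> phi Hphi /=; rewrite centerE.
  apply: filterS (linw 1 (- inner F phi (cst 1)) _ _ Hphi (L2_cst F 1)).
  by move=> o ->; rewrite mul1r mulNr.
Qed.

End bridge.

(** * From the bridge to a Brownian motion *)

Section bridge_to_motion.
Context {d1 : measure_display} {T : measurableType d1} {R : realType}.
Variables (mu : {measure set T -> \bar R}) (F : probability T R) (f : T -> R).
Implicit Types phi psi : T -> R.
Hypothesis mf : measurable_fun setT f.
Hypothesis f_ge0 : forall x, 0 <= f x.
Hypothesis f_gt0 : {ae mu, forall x, 0 < f x}.
Hypothesis F_density : forall h : T -> R, measurable_fun setT h ->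
  (\int[F]_x (h x)%:E = \int[mu]_x (h x * f x)%:E)%E.

Let s : T -> R := fun x => Num.sqrt (f x).

Let ms : measurable_fun setT s.
Proof.
exact: measurableT_comp (continuous_measurable_fun (@sqrt_continuous R)) mf.
Qed.

Let ss x : s x * s x = f x.
Proof. by rewrite -expr2 sqr_sqrtr. Qed.

Let s_neq0 : {ae mu, forall x, s x != 0}.
Proof. by apply: filterS f_gt0 => x fx; rewrite gt_eqF// sqrtr_gt0. Qed.

Let ms1 : measurable_fun setT (fun x => (s x)^-1).
Proof.
under eq_fun do rewrite -powR_inv1 ?sqrtr_ge0//.
exact: measurableT_comp (measurable_powR (-1)) ms.
Qed.

Let mdiv phi : measurable_fun setT phi ->
  measurable_fun setT (fun x => phi x / s x).
Proof. by move=> mphi; exact: measurable_funM. Qed.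

Let f_mass : (\int[mu]_x (f x)%:E = 1)%E.
Proof.
have <- : F setT = 1%E by exact: probability_setT.
rewrite -(mul1e (F setT)) -integral_cst// F_density//.
by apply: eq_integral => x _; rewrite mul1r.
Qed.

Lemma L2_sqrt_density : L2 mu s.
Proof.
apply/L2P; split=> //.
by under eq_integral do rewrite expr2 ss; rewrite f_mass ltry.
Qed.

Lemma inner_sqrt_density : inner mu s s = 1.
Proof.
apply: EFin_inj; rewrite inner_self; last exact: L2_sqrt_density.
by under eq_integral do rewrite expr2 ss; rewrite f_mass.
Qed.

Lemma inner_density phi psi :
  measurable_fun setT phi -> measurable_fun setT psi ->
  inner F phi psi = inner mu (fun x => phi x * s x) (fun x => psi x * s x).
Proof.
move=> m1 m2; rewrite /inner /Rintegral F_density; last exact: measurable_funM.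
by congr fine; apply: eq_integral => x _; rewrite -ss mulrACA.
Qed.

(** The density [s^2] of [F] cancels the two factors [1 / s] wherever [s] is
    nonzero, which is [mu]-almost everywhere. *)
Lemma inner_div phi psi : measurable_fun setT phi -> measurable_fun setT psi ->
  inner F (fun x => phi x / s x) (fun x => psi x / s x) = inner mu phi psi.
Proof.
move=> m1 m2; rewrite inner_density; try exact: mdiv.
apply: ae_eq_inner; try exact: measurable_funM.
  by apply: measurable_funM; apply: measurable_funM => //; exact: mdiv.
by apply: filterS s_neq0 => x s0; rewrite !divfK.
Qed.

Lemma inner_div1 phi : measurable_fun setT phi ->
  inner F (fun x => phi x / s x) (cst 1) = inner mu phi s.
Proof.
move=> m1; rewrite inner_density//; last exact: mdiv.
apply: ae_eq_inner; try exact: measurable_funM.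
  by apply: measurable_funM; apply: measurable_funM => //; exact: mdiv.
by apply: filterS s_neq0 => x s0; rewrite divfK// mul1r.
Qed.

Lemma L2_div phi : L2 mu phi -> L2 F (fun x => phi x / s x).
Proof.
move=> Hphi; have mphi := L2_measurable Hphi.
have mphis := mdiv mphi; apply/L2P; split=> //.
rewrite F_density; last exact: measurable_funX.
have /L2P[_] := Hphi; apply: le_lt_trans.
rewrite le_eqVlt; apply/orP; left; apply/eqP; apply: ae_eq_integral => //.
- apply/measurable_EFinP; apply: measurable_funM => //.
  exact: measurable_funX.
- by apply/measurable_EFinP; exact: measurable_funX.
- by apply: filterS s_neq0 => x s0 _; rewrite -ss -expr2 -exprMn divfK.
Qed.

Variable e : T -> R.
Hypothesis e_L2 : L2 mu e.
Hypothesis e_norm : inner mu e e = 1.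
Hypothesis e_neq : ~ {ae mu, forall x, e x = s x}.

Let h := inner mu e s.

(* The form in which the closure and linearity lemmas apply. *)
Let eBsE : (fun x => e x - s x) = (fun x => 1 * e x + (-1) * s x).
Proof. by apply/funext => x; rewrite mul1r mulN1r. Qed.

Let L2_eBs : L2 mu (fun x => e x - s x).
Proof. by rewrite eBsE; apply: L2_lin => //; exact: L2_sqrt_density. Qed.

Let inner_eBs phi : L2 mu phi ->
  inner mu phi (fun x => e x - s x) = inner mu phi e - inner mu phi s.
Proof.
move=> Hphi; rewrite eBsE inner_linr//; last exact: L2_sqrt_density.
by rewrite mul1r mulN1r.
Qed.

(** The equality case of Cauchy-Schwarz for the unit vectors [e] and [s]:
    [|e - s|^2 = 2 (1 - h)]. *)
Lemma inner_neq1 : h != 1.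
Proof.
apply/eqP => h1; apply: e_neq; have Hs := L2_sqrt_density.
have : inner mu (fun x => e x - s x) (fun x => e x - s x) = 0.
  rewrite inner_eBs// eBsE !inner_lin// e_norm inner_sqrt_density.
  by rewrite (inner_sym mu s e) -/h h1; ring.
move/(inner_self_eq0 L2_eBs); apply: filterS => x /eqP.
by rewrite subr_eq0 => /eqP.
Qed.

Let subr_h_neq0 : 1 - h != 0.
Proof. by rewrite subr_eq0 eq_sym inner_neq1. Qed.

Context {d2 : measure_display} {O : measurableType d2}.
Variables (P : probability O R) (v : (T -> R) -> O -> R).
Hypothesis v_bridge : brownian_bridge F P v.

Definition bridge_transform (phi : T -> R) : O -> R := fun o =>
  v (fun x => phi x / s x) o - v (fun x => e x / s x) o * (1 / (1 - h)) *
    inner mu phi (fun x => e x - s x).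

Let coef phi := - (1 / (1 - h)) * inner mu phi (fun x => e x - s x).

(* With [U] the reflection that exchanges [e] and [s], [center F (lift phi)] is
   [U phi / s] when [phi] is orthogonal to [e]: the
   component along [s / s = 1] of the reflection is left out here because the
   bridge does not see it. *)
Let lift phi := fun x => 1 * (phi x / s x) + coef phi * (e x / s x).

(** The process is [v] reindexed by [lift], up to almost sure equality, and
    [center F \o lift] is an isometry on the orthogonal complement of [e]. *)
Lemma bridge_transform_motion (D : set (T -> R)) :
  lin_closed D -> D `<=` L2 mu -> (forall phi, D phi -> inner mu phi e = 0) ->
  gaussian_field (inner mu) D P bridge_transform.
Proof.
move=> Dlin DL2 De; have Hs := L2_sqrt_density.
have vf := bridge_field v_bridge.
have Hes := L2_div e_L2.
have Dlift phi : D phi -> L2 F (lift phi).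
  by move=> /DL2 Hphi; apply: L2_lin => //; exact: L2_div.
have lin_lift a b phi psi : D phi -> D psi ->
    lift (fun x => a * phi x + b * psi x) =
    (fun x => a * lift phi x + b * lift psi x).
  move=> /DL2 H1 /DL2 H2; apply/funext => x.
  by rewrite /lift /coef inner_lin//; ring.
have cov phi psi : D phi -> D psi ->
    inner F (center F (lift phi)) (center F (lift psi)) = inner mu phi psi.
  move=> D1 D2; have H1 := DL2 _ D1; have H2 := DL2 _ D2.
  have [G1 G2] := (L2_div H1, L2_div H2).
  have [m1 m2] := (L2_measurable H1, L2_measurable H2).
  have me := L2_measurable e_L2.
  have G0 := L2_cst F 1.
  (* [<phi, e> = <psi, e> = 0] and [<e, e> = 1] leave a rational identity in
     [<phi, psi>], [<phi, s>], [<psi, s>] and [h]. *)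
  rewrite inner_center; try exact: Dlift.
  rewrite {1}/lift inner_lin//; last exact: Dlift.
  rewrite /lift !inner_linr// !inner_lin// !inner_div// !inner_div1//.
  rewrite /coef !inner_eBs// (inner_sym mu e psi) (De phi)// (De psi)//.
  by rewrite e_norm -/h; field.
have [m l g c cv] : gaussian_field
    (fun phi psi => inner F (center F (lift phi)) (center F (lift psi))) D P
    bridge_transform.
  apply: (gaussian_field_ae Dlin (gaussian_field_comp vf Dlift lin_lift)).
  - move=> phi /DL2 Hphi; apply: measurable_funB.
      by apply: (field_measurable vf); exact: L2_div.
    apply: measurable_funM => //; apply: measurable_funM => //.
    exact: (field_measurable vf).
  - move=> phi /DL2 Hphi /=.
    apply: filterS (field_linear vf 1 (coef phi) (L2_div Hphi) Hes) => o ->.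
    by rewrite /bridge_transform /coef; ring.
split=> // phi psi D1 D2; by rewrite cv// cov.
Qed.

Lemma bridge_transform_self o : bridge_transform e o = 0.
Proof.
by rewrite /bridge_transform inner_eBs// e_norm -/h; field.
Qed.

End bridge_to_motion.

(** * Densities and restricted measures *)

Section density.
Context {disp : measure_display} {T : measurableType disp} {R : realType}.

Lemma ae_mrestr (mu : {measure set T -> \bar R}) (D : set T)
    (mD : measurable D) (Q : T -> Prop) :
  {ae mrestr mu mD, forall x, Q x} <-> {ae mu, forall x, D x -> Q x}.
Proof.
split=> -[N [mN N0 QN]].
  exists (N `&` D); split; [exact: measurableI|exact: N0|].
  by move=> x /= /not_implyP[Dx Qx]; split=> //; exact: QN.
exists (N `|` ~` D); split.
- by apply: measurableU => //; exact: measurableC.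
- rewrite -[LHS]/(mu ((N `|` ~` D) `&` D)).
  apply: (subset_measure0 (B := N)) => //.
  + by apply: measurableI => //; apply: measurableU => //; exact: measurableC.
  + by move=> x [[]].
- move=> x /= Qx; have [Dx|Dx] := pselect (D x); last by right.
  by left; apply: QN => /= /(_ Dx).
Qed.

(** The complement of [D] is null for the restricted measure, and the two
    measures agree on the measurable subsets of [D]. *)
Lemma integral_mrestr (mu : {measure set T -> \bar R}) (D : set T)
    (mD : measurable D) (g : T -> R) : measurable_fun setT g ->
  (\int[mrestr mu mD]_x (g x)%:E = \int[mu]_(x in D) (g x)%:E)%E.
Proof.
move=> mg; transitivity (\int[mrestr mu mD]_(x in D) (g x)%:E)%E.
  rewrite [RHS]integral_mkcond; apply: ae_eq_integral => //.
  - exact/measurable_EFinP.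
  - apply/(measurable_restrictT _ _).1 => //.
    by apply: measurable_funTS; exact/measurable_EFinP.
  - apply/ae_mrestr; apply: aeW => x Dx _.
    by rewrite patchE mem_set.
apply: eq_measure_integral => B mB BD.
by rewrite -[LHS]/(mu (B `&` D)) setIidl.
Qed.

(** A Radon-Nikodym derivative is unique almost everywhere, so [f] can stand for
    the abstract one, for which the change of variables of nonnegative functions
    is known. *)
Lemma integral_density (mu : {sigma_finite_measure set T -> \bar R})
    (F : probability T R) (f : T -> R) :
  measurable_fun setT f -> (forall x, 0 <= f x) ->
  (forall B, measurable B -> F B = \int[mu]_(x in B) (f x)%:E)%E ->
  forall h : T -> R, measurable_fun setT h ->
  (\int[F]_x (h x)%:E = \int[mu]_x (h x * f x)%:E)%E.
Proof.
move=> mf f0 Ff h mh; have mEf : measurable_fun setT (EFin \o f).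
  exact/measurable_EFinP.
have Fmu : F `<< mu.
  apply/null_content_dominatesP => B mB B0; rewrite Ff//.
  apply: null_set_integral => //.
  exact: measurable_funTS.
pose g := Radon_Nikodym_SigmaFinite.f F mu.
have ig := Radon_Nikodym_SigmaFinite.f_integrable Fmu.
have gf : ae_eq mu setT g (EFin \o f).
  apply: integral_ae_eq => // B _ mB.
  by rewrite -Radon_Nikodym_SigmaFinite.f_integral//; exact: Ff.
have ge0 (k : T -> \bar R) : (forall x, 0 <= k x)%E ->
    measurable_fun setT k -> (\int[F]_x k x = \int[mu]_x (k x * (f x)%:E))%E.
  move=> k0 mk; rewrite -(Radon_Nikodym_SigmaFinite.change_of_variables Fmu)//.
  apply: ae_eq_integral => //.
  - by apply: emeasurable_funM => //; exact: measurable_int ig.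
  - exact: emeasurable_funM.
  - exact: ae_eqe_mul2l.
have mEh : measurable_fun setT (EFin \o h) by exact/measurable_EFinP.
rewrite integralE [RHS]integralE !ge0//; last 2 first.
  exact: measurable_funeneg.
  exact: measurable_funepos.
congr (_ - _)%E; apply: eq_integral => x _.
  by rewrite !funeposE EFinM muleC [in RHS]muleC maxe_pMr ?lee_fin// mule0.
by rewrite !funenegE EFinM muleC [in RHS]muleC -muleN maxe_pMr ?lee_fin// mule0.
Qed.

(** Since [F] does not charge the complement of [D], [h] can be replaced by
    [h * \1_D] before the density is brought in. *)
Lemma integral_density_mrestr (mu : {sigma_finite_measure set T -> \bar R})
    (F : probability T R) (f : T -> R) (D : set T) (mD : measurable D) :
  measurable_fun setT f -> (forall x, 0 <= f x) ->
  (forall B, measurable B -> F B = \int[mu]_(x in B) (f x)%:E)%E ->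
  F D = 1%E -> forall h : T -> R, measurable_fun setT h ->
  (\int[F]_x (h x)%:E = \int[mrestr mu mD]_x (h x * f x)%:E)%E.
Proof.
move=> mf f0 Ff FD h mh; rewrite integral_mrestr; last exact: measurable_funM.
have mhD : measurable_fun setT (fun x => h x * \1_D x).
  by apply: measurable_funM => //; exact: measurable_indic.
have FDC : F (~` D) = 0%E by rewrite probability_setC// FD subee.
transitivity (\int[F]_x (h x * \1_D x)%:E)%E.
  apply: ae_eq_integral => //; try exact/measurable_EFinP.
  exists (~` D); split; [exact: measurableC|exact: FDC|].
  move=> x /= + Dx; apply => _; by rewrite indicE mem_set// mulr1.
rewrite (integral_density mf f0 Ff)// [RHS]integral_mkcond.
apply: eq_integral => x _; rewrite patchE indicE.
by case: (x \in _); rewrite ?mulr1// mulr0 mul0r.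
Qed.

Lemma integral_support (mu : {measure set T -> \bar R}) (A D : set T)
    (g : T -> R) : A `<=` D -> (forall x, ~ A x -> g x = 0) ->
  (\int[mu]_(x in A) (g x)%:E = \int[mu]_(x in D) (g x)%:E)%E.
Proof.
move=> AD gA; rewrite [LHS]integral_mkcond [RHS]integral_mkcond.
apply: eq_integral => x _; rewrite !patchE.
have [xA|xA] := boolP (x \in A).
  by rewrite mem_set//; apply: AD; rewrite inE in xA.
by case: ifP => // _; rewrite gA//; move/negP: xA; rewrite inE.
Qed.

End density.

(** * The cube *)

Theorem theorem6 (R : realType) (d : nat)
  (F : probability (Rd R d) R) (f : Rd R d -> R)
  (mf : measurable_fun [set: Rd R d] f)
  (f_ge0 : forall x, 0 <= f x)
  (F_density : forall B : set (Rd R d), measurable B ->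
     F B = (\int[lebesgue_Rd R d]_(x in B) (f x)%:E)%E)
  (F_cube : F (cube R d) = 1%E)
  (f_gt0 : {ae lebesgue_Rd R d, forall x, cube R d x -> 0 < f x})
  (dO : measure_display) (O : measurableType dO) (P : probability O R)
  (v : (Rd R d -> R) -> O -> R) (v_bridge : brownian_bridge F P v)
  (A : set (Rd R d)) (mA : measurable A) (A_cube : A `<=` cube R d)
  (eta : Rd R d -> R) (meta : measurable_fun [set: Rd R d] eta)
  (eta_ge0 : forall x, 0 <= eta x)
  (eta_out : forall x, ~ A x -> eta x = 0)
  (eta_density : (\int[lebesgue_Rd R d]_(x in A) (eta x ^+ 2)%:E = 1)%E)
  (eta_neq : ~ {ae lebesgue_Rd R d, forall x, cube R d x ->
                  eta x = Num.sqrt (f x)}) :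
  let b := transformed v f A eta in
  brownian_on (lebesgue_cube R d)
    [set phi | L2 (lebesgue_cube R d) phi /\
               {ae lebesgue_Rd R d, forall x, A x -> phi x = 0}] P b /\
  {ae P, forall o, b (fun y => eta y * \1_A y) o = 0}.
Proof.
pose lam := lebesgue_Rd R d; pose mu := lebesgue_cube R d.
pose mcube := @measurable_cube R d.
pose s := fun x => Num.sqrt (f x).
have ms : measurable_fun setT s.
  exact: measurableT_comp (continuous_measurable_fun (@sqrt_continuous R)) mf.
have int_cube g : measurable_fun setT g ->
    (\int[mu]_x (g x)%:E = \int[lam]_(x in cube R d) (g x)%:E)%E.
  exact: integral_mrestr.
have int_A g : (forall x, ~ A x -> g x = 0) ->
    (\int[lam]_(x in A) (g x)%:E = \int[lam]_(x in cube R d) (g x)%:E)%E.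
  exact: integral_support.
have F_dens := integral_density_mrestr mcube mf f_ge0 F_density F_cube.
have f_pos : {ae mu, forall x, 0 < f x} by exact/ae_mrestr.
have eta_sq : (\int[mu]_x (eta x ^+ 2)%:E = 1)%E.
  rewrite int_cube; last exact: measurable_funX.
  by rewrite -int_A// => x /eta_out ->; rewrite expr0n.
have eta_L2 : L2 mu eta by apply/L2P; split=> //; rewrite eta_sq ltry.
have eta_norm : inner mu eta eta = 1.
  by apply: EFin_inj; rewrite inner_self.
have eta_ne : ~ {ae mu, forall x, eta x = s x} by move/ae_mrestr.
have bE phi o : measurable_fun setT phi ->
    bridge_transform mu f eta v phi o = transformed v f A eta phi o.
  move=> mphi; rewrite /bridge_transform /transformed /inner /Rintegral.
  rewrite !int_cube; last 2 first.
    by apply: measurable_funM => //; exact: measurable_funB.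
    exact: measurable_funM.
  by rewrite -int_A// => x /eta_out ->; rewrite mul0r.
move=> b; split; last first.
  apply: aeW => o.
  have -> : (fun y => eta y * \1_A y) = eta.
    apply/funext => x; rewrite indicE.
    by have [|/negP] := boolP (x \in A); rewrite inE ?mulr1// mulr0 => /eta_out.
  rewrite /b -bE//.
  exact: (bridge_transform_self mf f_ge0 F_dens eta_L2 eta_norm eta_ne).
pose D := [set phi | L2 mu phi /\ {ae lam, forall x, A x -> phi x = 0}].
have Dlin : lin_closed D.
  move=> a c phi psi [H1 Z1] [H2 Z2]; split; first exact: L2_lin.
  by apply: filterS2 Z1 Z2 => x z1 z2 Ax; rewrite z1// z2// !mulr0 addr0.
have Deta phi : D phi -> inner mu phi eta = 0.
  move=> [H1 Z1]; transitivity (inner mu (cst 0) (cst 0)).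
    apply: ae_eq_inner.
    - by apply: measurable_funM => //; exact: L2_measurable H1.
    - exact: measurable_funM.
    - apply/ae_mrestr; apply: filterS Z1 => x z1 _; rewrite mul0r.
      have [/z1 ->|/eta_out ->] := pselect (A x); by rewrite ?mul0r ?mulr0.
  rewrite /inner; under eq_Rintegral do rewrite mul0r.
  by rewrite /Rintegral integral0.
have DL2 : D `<=` L2 mu by move=> phi [].
have bt := bridge_transform_motion mf f_ge0 f_pos F_dens eta_L2 eta_norm eta_ne
  v_bridge Dlin DL2 Deta.
have bD phi : D phi -> bridge_transform mu f eta v phi = b phi.
  by move=> [/L2_measurable mphi _]; apply/funext => o; exact: bE.
have [mb lb gb cb covb] : gaussian_field (inner mu) D P b.
  apply: (gaussian_field_ae Dlin bt) => phi Dphi.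
    by rewrite -bD//; exact: (field_measurable bt).
  by apply: aeW => o; rewrite bD.
by split.
Qed.
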